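(* For $k\geq 2$ and $d > k(k-1)/2$, every $k$-uniform hypergraph $H$ with $d_1(H) \geq d$ satisfies $\mathrm{ex}(n,H)\geq\Omega_k\left(n^{k-k(k-1)/d}\right)$.
   Context: The skeletal degeneracy $d_1(H)$ of a $k$-uniform hypergraph $H$ is the degeneracy of its $1$-skeleton (the graph on $V(H)$ joining two vertices iff they lie in a common edge of $H$), i.e. the least $d$ such that every subgraph of that graph has minimum degree at most $d$. $\mathrm{ex}(n,H)$ is the maximum number of edges in an $n$-vertex $k$-uniform hypergraph with no copy of $H$. $\Omega_k(f(n))$ denotes a quantity at least $cf(n)$ for a constant $c>0$ depending only on $k$ (for all sufficiently large $n$). *)

(* Defs.v *)
From mathcomp Require Import all_boot all_order all_algebra.
From mathcomp Require Import reals exp.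

Set Implicit Arguments.
Unset Strict Implicit.
Unset Printing Implicit Defensive.

(* A hypergraph has all of V as vertex set (isolated vertices are allowed); a
   simple graph is a 2-uniform hypergraph. *)
Definition hypergraph (V : finType) := {set {set V}}.

Section Hypergraphs.
Variable V : finType.
Implicit Types (H G F : hypergraph V) (S : {set V}) (v : V) (d k : nat).

Definition uniform k H : bool := [forall e in H, #|e| == k].

Definition skeleton1 H : hypergraph V :=
  [set f : {set V} | (#|f| == 2) && [exists e in H, f \subset e]].

(* (S, F) ranges over all subgraphs, not only the induced ones. *)
Definition subgraph S F G : bool :=
  (F \subset G) && [forall f in F, f \subset S].

Definition degree F v : nat := #|[set f in F | v \in f]|.

(* Degrees never exceed #|F|, so the default value #|F| only matters when S is
   empty, a case excluded below. *)
Definition min_degree S F : nat := \big[minn/#|F|]_(v in S) degree F v.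

Definition degenerate G d : bool :=
  [forall S : {set V}, forall F : hypergraph V,
    (S != set0) && subgraph S F G ==> (min_degree S F <= d)].

Lemma degenerate_exists G : exists d, degenerate G d.
Proof.
exists #|G|; apply/forallP=> S; apply/forallP=> F; apply/implyP.
case/andP=> _ /andP[sFG _]; apply: leq_trans (subset_leq_card sFG).
rewrite /min_degree; elim/big_rec: _ => // v m _ le_m.
by rewrite geq_min le_m orbT.
Qed.

Definition degeneracy G : nat := ex_minn (degenerate_exists G).

Definition skeletal_degeneracy H : nat := degeneracy (skeleton1 H).

End Hypergraphs.

(* A copy of H in G is a not necessarily induced subhypergraph. *)
Definition has_copy (V W : finType) (H : hypergraph V) (G : hypergraph W) :=
  [exists f : {ffun V -> W},
    injectiveb f && [forall e in H, (f @: e) \in G]].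

Definition ex (k n : nat) (V : finType) (H : hypergraph V) : nat :=
  \max_(G : hypergraph 'I_n | uniform k G && ~~ has_copy H G) #|G|.

(* Main.v *)
Require Import Defs.
From mathcomp Require Import all_boot all_order all_algebra.
From mathcomp Require Import reals exp.
From mathcomp Require Import zify ring lra.

(* The 1-skeleton of H contains a graph F on a vertex set S of minimum degree at
   least d, hence with at least d|S|/2 edges. Let G be the random graph on n
   vertices with edge probability p = n^(-2/d), so that the expected number of
   copies of F in G is at most n^|S| p^|F| <= 1. Take the k-cliques of G as
   hyperedges, and delete those that contain the image of one fixed edge of F
   under some copy of F in G: every copy of H would induce such a copy of F, so
   the remaining hypergraph is H-free. In expectation there are
   'C(n, k) p^'C(k, 2), of order n^(k - k(k-1)/d), cliques, and at most n^(k-2)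
   of them are deleted, which is of lower order because d > k(k-1)/2. *)

Set Implicit Arguments.
Unset Strict Implicit.

Import Order.TTheory GRing.Theory Num.Theory.
Local Open Scope ring_scope.

(** * Random subsets of a finite type *)

Section RandomSubset.
Variables (R : realDomainType) (T : finType) (p : R).

(** The probability of [G] when each element is kept independently with probability [p];
    expectations become finite weighted sums. *)
Definition subset_weight (G : {set T}) : R :=
  \prod_x (if x \in G then p else 1 - p).

Lemma subset_weight_ge0 (G : {set T}) : 0 <= p <= 1 -> 0 <= subset_weight G.
Proof.
by case/andP=> p_ge0 p_le1; apply: prodr_ge0 => x _; case: ifP; rewrite ?subr_ge0.
Qed.

Lemma sum_subset_weight_superset (A : {set T}) :
  \sum_(G : {set T} | A \subset G) subset_weight G = p ^+ #|A|.
Proof.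
(* The summand 0 forbids omitting an element of [A], so expanding the product leaves exactly the
   supersets of [A]. *)
transitivity (\prod_x (p + (if x \in A then 0 else 1 - p))).
  rewrite bigA_distr big_mkcond /=; apply: eq_bigr => G _.
  case: ifPn => [/subsetP sAG | /subsetPn[x xA xNG]].
    apply: eq_bigr => x _; case: ifPn => // xNG.
    by rewrite (contraNF (sAG x)).
  by rewrite (bigD1 x) //= (negPf xNG) xA mul0r.
rewrite (bigID (mem A)) /= [X in _ * X]big1 ?mulr1 => [|x /negPf->]; last first.
  by rewrite addrC subrK.
by rewrite -prodr_const; apply: eq_bigr => x ->; rewrite addr0.
Qed.

Lemma sum_subset_weight : \sum_(G : {set T}) subset_weight G = 1.
Proof.
have := sum_subset_weight_superset set0; rewrite cards0 expr0 => <-.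
by apply: eq_bigl => G; rewrite sub0set.
Qed.

(** Linearity of expectation over the events that [A i] lies in the random set. *)
Lemma expected_contained (I : finType) (P : pred I) (A : I -> {set T}) :
  \sum_(G : {set T}) subset_weight G * #|[set i | P i && (A i \subset G)]|%:R
  = \sum_(i | P i) p ^+ #|A i|.
Proof.
under eq_bigr => G _.
  rewrite -sum1_card natr_sum mulr_sumr.
  under eq_bigl => i do rewrite inE.
  rewrite big_mkcondr /=; over.
rewrite exchange_big /=; apply: eq_bigr => i _.
rewrite -sum_subset_weight_superset [RHS]big_mkcond /=; apply: eq_bigr => G _.
by rewrite mulr1.
Qed.

End RandomSubset.

Local Open Scope nat_scope.

(** * Degree sums and subgraphs of large minimum degree *)

Lemma sum_degree (V : finType) (S : {set V}) (F : hypergraph V) k :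
  uniform k F -> [forall f in F, f \subset S] ->
  \sum_(v in S) degree F v = k * #|F|.
Proof.
move=> /forall_inP uF /forall_inP sFS.
under eq_bigr => v _.
  rewrite /degree -sum1_card.
  under eq_bigl => f do rewrite inE.
  rewrite big_mkcondr /=; over.
rewrite exchange_big /= mulnC -sum_nat_const; apply: eq_bigr => f fF.
rewrite -big_mkcondr /= -(eqP (uF f fF)) -sum1_card; apply: eq_bigl => v.
by rewrite andb_idl // => /(subsetP (sFS f fF)).
Qed.

Lemma min_degree_le (V : finType) (S : {set V}) (F : hypergraph V) v :
  v \in S -> min_degree S F <= degree F v.
Proof.
move=> vS; rewrite /min_degree; have := mem_index_enum v.
elim: (index_enum V) => // u r IHr; rewrite inE big_cons.
case: eqVneq => [<- _ | _ /IHr le_r]; first by rewrite vS geq_minl.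
by case: ifP; rewrite // geq_min le_r orbT.
Qed.

(** By minimality, the bound [degeneracy G - 1] fails for some subgraph. *)
Lemma degeneracy_core (V : finType) (G : hypergraph V) :
  0 < degeneracy G ->
  exists S : {set V}, exists2 F : hypergraph V,
    (S != set0) && subgraph S F G
    & forall v, v \in S -> degeneracy G <= degree F v.
Proof.
rewrite /degeneracy; case: ex_minnP => -[//|D] _ minD _.
have: ~~ degenerate G D by apply/negP => /minD; rewrite ltnn.
case/forallPn=> S /forallPn[F]; rewrite negb_imply -ltnNge => /andP[SF ltD].
exists S, F => // v vS; exact: leq_trans ltD (min_degree_le F vS).
Qed.

Lemma imset_inj_in (V W : finType) (f : V -> W) (S A B : {set V}) :
  {in S &, injective f} -> A \subset S -> B \subset S ->
  f @: A = f @: B -> A = B.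
Proof.
move=> injf; suff sub (A' B' : {set V}) : A' \subset S -> B' \subset S ->
    f @: A' = f @: B' -> A' \subset B'.
  by move=> sA sB eqAB; apply/eqP; rewrite eqEsubset (sub A B) ?(sub B A).
move=> /subsetP sA /subsetP sB eqAB; apply/subsetP=> x xA.
have: f x \in f @: B' by rewrite -eqAB imset_f.
by case/imsetP=> y yB /injf-> //; [apply: sA | apply: sB].
Qed.

(** * Cliques, copies and the deletion argument *)

Section Cliques.
Variables (V W : finType).

Definition pairs (K : {set W}) : hypergraph W :=
  [set e : {set W} | e \subset K & #|e| == 2].

Definition cliques k (G : hypergraph W) : hypergraph W :=
  [set K : {set W} | (#|K| == k) && (pairs K \subset G)].

Definition edge_image (f : {ffun V -> W}) (F : hypergraph V) : hypergraph W :=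
  [set f @: e | e : {set V} in F].

Lemma card_edge_image (f : {ffun V -> W}) (S : {set V}) (F : hypergraph V) :
  {in S &, injective f} -> [forall e in F, e \subset S] ->
  #|edge_image f F| = #|F|.
Proof.
move=> injf /forall_inP sF; apply: card_in_imset => A B /sF sA /sF sB.
exact: imset_inj_in injf sA sB.
Qed.

(* Maps are required to send everything outside [S] to [w0], so that each copy
   of a graph on [S] is counted once. *)
Definition partial_inj (w0 : W) (S : {set V}) : pred {ffun V -> W} :=
  [pred f | (f \in pffun_on w0 S predT) && dinjectiveb f S].

Definition graph_copies w0 S F (G : hypergraph W) : {set {ffun V -> W}} :=
  [set f | partial_inj w0 S f && (edge_image f F \subset G)].

Lemma card_partial_inj w0 S : #|partial_inj w0 S| <= #|W| ^ #|S|.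
Proof.
have -> : #|W| ^ #|S| = #|pffun_on w0 (mem S) (predT : pred W)|.
  by rewrite card_pffun_on; congr (_ ^ _); apply: eq_card.
apply: subset_leq_card.
by apply/subsetP => f; rewrite inE => /andP[].
Qed.

(** [K] is determined by [K :\: e], which has [k - 2] elements. *)
Lemma card_supersets k (e : {set W}) : #|e| = 2 ->
  #|[set K : {set W} | (#|K| == k) && (e \subset K)]| <= #|W| ^ (k - 2).
Proof.
move=> card_e.
set A := [set K | _].
have injD : {in A &, injective (fun K => K :\: e)}.
  move=> K L; rewrite !inE => /andP[_ eK] /andP[_ eL] eqKL.
  rewrite -(setID K e) -(setID L e) eqKL.
  by rewrite (setIidPr eK) (setIidPr eL).
rewrite -(card_in_imset injD).
have sA : [set K :\: e | K in A]
    \subset [set L : {set W} | L \subset [set: W] & #|L| == k - 2].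
  apply/subsetP=> _ /imsetP[K + ->]; rewrite !inE => /andP[/eqP cK eK].
  by rewrite subsetT cardsD (setIidPr eK) cK card_e eqxx.
apply: leq_trans (subset_leq_card sA) _.
rewrite cards_draws cardsT.
have: 'C(#|W|, k - 2) <= #|W| ^_ (k - 2).
  by rewrite -bin_ffact leq_pmulr ?fact_gt0.
move/leq_trans; apply; rewrite ffact_prod.
rewrite -[X in _ ^ X]card_ord -prod_nat_const.
by apply: leq_prod => i _; apply: leq_subr.
Qed.

End Cliques.

(** The deletion step for a fixed [G]: each copy of [F] costs at most [n ^ (k - 2)] cliques, those
    through the image of [e0], and what is left is [H]-free. *)
Lemma cliques_le_ex (V : finType) (H : hypergraph V) k n (w0 : 'I_n) S F e0 G :
  subgraph S F (skeleton1 H) -> e0 \in F ->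
  #|cliques k G| <= ex k n H + #|graph_copies w0 S F G| * n ^ (k - 2).
Proof.
case/andP=> /subsetP sFH /forall_inP sFS e0F.
have card_F e : e \in F -> #|e| = 2.
  by move/sFH; rewrite inE => /andP[/eqP].
pose bad (f : {ffun V -> 'I_n}) :=
  [set K : {set 'I_n} | (#|K| == k) && (f @: e0 \subset K)].
pose B := \bigcup_(f in graph_copies w0 S F G) bad f.
have leB : #|B| <= #|graph_copies w0 S F G| * n ^ (k - 2).
  rewrite -sum_nat_const.
  apply: leq_trans (_ : \sum_(f in graph_copies w0 S F G) #|bad f| <= _).
    rewrite /B; elim/big_ind2: _ => [|A a C c lA lC|//].
      by rewrite cards0.
    by apply: leq_trans (leq_add lA lC); rewrite leq_card_setU.
  apply: leq_sum => f; rewrite inE => /andP[/andP[_ /dinjectiveP injf] _].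
  rewrite -[X in (X ^ _)%N](card_ord n) card_supersets //.
  rewrite card_in_imset ?card_F // => x y xe ye.
  by apply: injf; apply: (subsetP (sFS _ e0F)).
rewrite -(cardsID B (cliques k G)) addnC; apply: leq_add; last first.
  by apply: leq_trans leB; rewrite subset_leq_card ?subsetIr.
apply: (@leq_bigmax_cond _ _ (fun G' : hypergraph 'I_n => #|G'|)).
apply/andP; split.
  by apply/forall_inP=> K; rewrite !inE => /andP[_ /andP[]].
apply/negP=> /existsP[f /andP[/injectiveP injf /forall_inP copyf]].
(* Resetting [f] to [w0] off [S] gives the normal form required by [partial_inj] without changing
   the images of edges of [F]. *)
pose g := [ffun v => if v \in S then f v else w0].
have gE (e : {set V}) : e \subset S -> g @: e = f @: e.
  by move=> /subsetP eS; apply: eq_in_imset => v /eS vS; rewrite ffunE vS.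
have g_copy : g \in graph_copies w0 S F G.
  rewrite inE; apply/andP; split; [apply/andP; split|].
  - apply/pffun_onP; split=> [|//].
    by apply/subsetP=> v; rewrite inE ffunE; case: ifP; rewrite ?eqxx.
  - by apply/dinjectiveP=> u v uS vS; rewrite !ffunE uS vS => /injf.
  apply/subsetP=> _ /imsetP[e eF ->]; rewrite gE ?sFS //.
  (* The image of a hyperedge [h] containing [e] is a clique of [G], so the image of [e] is an edge
     of [G]. *)
  have := sFH e eF; rewrite inE => /andP[_ /exists_inP[h hH eh]].
  have := copyf h hH; rewrite !inE => /andP[_ /andP[_ /subsetP]]; apply.
  by rewrite inE imsetS //= card_imset // card_F.
(* A hyperedge through [e0] is sent to a clique that was deleted. *)
have := sFH e0 e0F; rewrite inE => /andP[_ /exists_inP[h hH eh]].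
have := copyf h hH; rewrite inE => /andP[/negP notB]; rewrite inE => /andP[ch _].
apply: notB; apply/bigcupP; exists g => //.
by rewrite inE ch gE ?sFS // imsetS.
Qed.

Local Open Scope ring_scope.

Lemma binomial_le_ex (R : realDomainType) (p : R) (V : finType)
    (H : hypergraph V) k n S F :
  0 <= p <= 1 -> (0 < n)%N -> subgraph S F (skeleton1 H) -> F != set0 ->
  'C(n, k)%:R * p ^+ 'C(k, 2) <=
    (ex k n H)%:R + (n ^ #|S|)%:R * p ^+ #|F| * (n ^ (k - 2))%:R.
Proof.
move=> p01 n_gt0 sF /set0Pn[e0 e0F]; pose w0 := Ordinal n_gt0.
have sFS : [forall e in F, e \subset S] by case/andP: sF.
(* The random family may contain any subset of ['I_n], not only pairs; cliques and copies of [F]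
   only test pairs, so the expectations are those of the random graph. *)
pose w := @subset_weight R {set 'I_n} p.
have -> : 'C(n, k)%:R * p ^+ 'C(k, 2) =
    \sum_(G : hypergraph 'I_n) w G * #|cliques k G|%:R.
  rewrite (expected_contained p (fun K : {set 'I_n} => #|K| == k)
    (@pairs _)).
  rewrite (eq_bigr (fun=> p ^+ 'C(k, 2))) => [|K /eqP cK]; last first.
    by rewrite cards_draws cK.
  rewrite sumr_const mulr_natl; congr (_ *+ _).
  rewrite -{1}(card_ord n) -cardsT -cards_draws -[RHS]cardsE.
  by apply: eq_card => K; rewrite !inE subsetT.
have copies_le : \sum_(G : hypergraph 'I_n) w G * #|graph_copies w0 S F G|%:R
    <= (n ^ #|S|)%:R * p ^+ #|F|.
  rewrite (expected_contained p (partial_inj w0 S)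
    (fun f => edge_image f F)).
  (* Injectivity on [S] keeps the edge images distinct. *)
  rewrite (eq_bigr (fun=> p ^+ #|F|)) => [|f /andP[_ /dinjectiveP injf]]; last first.
    by rewrite (card_edge_image (S := S)).
  rewrite sumr_const -[X in X <= _]mulr_natl ler_wpM2r ?exprn_ge0 //.
    by case/andP: p01.
  by rewrite ler_nat -[X in (X ^ _)%N](card_ord n) card_partial_inj.
apply: le_trans (_ : \sum_(G : hypergraph 'I_n) w G * ((ex k n H)%:R +
    #|graph_copies w0 S F G|%:R * (n ^ (k - 2))%:R) <= _).
  apply: ler_sum => G _; rewrite ler_wpM2l ?subset_weight_ge0 //.
  by rewrite -natrM -natrD ler_nat; apply: cliques_le_ex sF e0F.
under eq_bigr do rewrite mulrDr mulrA.
rewrite big_split /= -!mulr_suml sum_subset_weight mul1r lerD2l.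
by rewrite ler_wpM2r.
Qed.

Lemma expn_le_binomial k n :
  (2 * k <= n)%N -> (n ^ k <= 2 ^ k * k`! * 'C(n, k))%N.
Proof.
move=> le_kn; rewrite -mulnA [(k`! * _)%N]mulnC bin_ffact ffact_prod.
rewrite -{1 2}[k]card_ord -!prod_nat_const -big_split /=.
(* Each factor satisfies [n <= 2 * (n - i)], as [i < k] and [2 * k <= n]. *)
by apply: leq_prod => i _; have := ltn_ord i; lia.
Qed.

Lemma eventually_ge_powR (R : realType) (a eps : R) : 0 < eps ->
  exists N : nat, forall n : nat, (N <= n)%N -> a <= n%:R `^ eps.
Proof.
move=> eps_gt0; pose b := Num.max a 1.
have b_gt0 : 0 < b by rewrite lt_max ltr01 orbT.
exists (Num.truncn (b `^ eps^-1)).+1 => n le_n.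
have le_bn : b `^ eps^-1 <= n%:R.
  by apply: le_trans (ltW (truncnS_gt _)) _; rewrite ler_nat.
apply: (@le_trans _ _ b); first by rewrite le_max lexx.
have -> : b = (b `^ eps^-1) `^ eps.
  by rewrite -powRrM mulVf ?gt_eqF // powRr1 // ltW.
by rewrite ge0_ler_powR ?nnegrE ?powR_ge0 // ltW.
Qed.

(** Summing the degrees of a subgraph of large minimum degree gives the edge density that the choice
    of [p] relies on. *)
Lemma dense_core (V : finType) (H : hypergraph V) :
  (0 < skeletal_degeneracy H)%N ->
  exists S : {set V}, exists2 F : hypergraph V,
    subgraph S F (skeleton1 H) /\ F != set0
    & (skeletal_degeneracy H * #|S| <= 2 * #|F|)%N.
Proof.
move=> D_gt0; case: (degeneracy_core D_gt0) => S [F /andP[S_neq0 sF] leD].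
have [sFG FS] := andP sF.
have uF : uniform 2 F.
  by apply/forall_inP=> e /(subsetP sFG); rewrite inE => /andP[].
have le_F : (skeletal_degeneracy H * #|S| <= 2 * #|F|)%N.
  by rewrite -(sum_degree uF FS) mulnC -sum_nat_const; apply: leq_sum.
exists S, F => //; split=> //; rewrite -card_gt0.
suff: (0 < 2 * #|F|)%N by rewrite muln_gt0.
by apply: leq_trans le_F; rewrite muln_gt0 D_gt0 card_gt0.
Qed.

(** The error [m * b] is at most half of [x] and is absorbed on the left. *)
Lemma le_absorb (R : realFieldType) (x m a b : R) :
  x <= m * (a + b) -> 2 * m * b <= x -> x <= a * (2 * m).
Proof. lra. Qed.

Theorem theorem3p3 (R : realType) (k : nat) (hk : (2 <= k)%N) :
  exists c : R, 0 < c /\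
    forall (d : R), k%:R * (k%:R - 1) / 2 < d ->
    forall (V : finType) (H : hypergraph V),
      uniform k H -> d <= (skeletal_degeneracy H)%:R ->
    exists N : nat, forall n : nat, (N <= n)%N ->
      c * n%:R `^ (k%:R - k%:R * (k%:R - 1) / d) <= (ex k n H)%:R.
Proof.
pose M : R := (2 ^ k * k`!)%:R.
have M_gt0 : 0 < M by rewrite ltr0n muln_gt0 expn_gt0 fact_gt0.
(* [M] comes from [n ^ k <= M * 'C(n, k)], the 2 from absorbing the deleted cliques. *)
exists (2 * M)^-1; split; first by rewrite invr_gt0 mulr_gt0.
move=> d lt_kd V H _ le_dD.
have k_ge2 : 2 <= k%:R :> R by rewrite (ler_nat R 2).
have d_gt0 : 0 < d.
  by apply: le_lt_trans lt_kd; rewrite divr_ge0 ?mulr_ge0 ?ler0n //; lra.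
have D_gt0 : (0 < skeletal_degeneracy H)%N.
  by rewrite -(ltr_nat R); apply: lt_le_trans le_dD.
have [S [F [sF F_neq0] leF]] := dense_core D_gt0.
(* The gap between the target exponent and [k - 2], positive because [d > k(k-1)/2]. *)
pose eps : R := 2 - k%:R * (k%:R - 1) / d.
have eps_gt0 : 0 < eps.
  by rewrite subr_gt0 ltr_pdivrMr // -ltr_pdivrMl // mulrC.
have [N0 leN0] := eventually_ge_powR (2 * M) eps_gt0.
exists (maxn N0 (maxn 1 (2 * k))) => n.
rewrite !geq_max => /and3P[le_N0n n_gt0 le_kn].
have n_ge1 : 1 <= n%:R :> R by rewrite (ler_nat R 1).
have nR_gt0 : 0 < n%:R :> R by apply: lt_le_trans n_ge1.
have powD (x y : R) : n%:R `^ (x + y) = n%:R `^ x * n%:R `^ y.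
  by rewrite powRD //; apply/implyP=> _; rewrite gt_eqF.
pose p : R := n%:R `^ (- (2 / d)).
have expp m : p ^+ m = n%:R `^ (- (2 / d * m%:R)).
  by rewrite -powR_mulrn ?powR_ge0 // -powRrM mulNr.
have p01 : 0 <= p <= 1.
  rewrite powR_ge0 /= -[leRHS](powRr0 n%:R); apply: ler_powR => //.
  by rewrite oppr_le0 divr_ge0 // ltW.
have := @binomial_le_ex R p V H k n S F p01 n_gt0 sF F_neq0.
have copies_le1 : (n ^ #|S|)%:R * p ^+ #|F| <= 1.
  rewrite natrX -powR_mulrn ?ler0n // expp -powD -[leRHS](powRr0 n%:R).
  (* The exponent [|S| - 2|F|/d] is at most 0 by the density of [F]. *)
  apply: ler_powR => //; rewrite subr_le0 mulrAC ler_pdivlMr //.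
  rewrite -natrM mulrC.
  apply: le_trans (_ : (skeletal_degeneracy H * #|S|)%:R <= _).
    by rewrite natrM ler_wpM2r.
  by rewrite ler_nat.
have pairsE : p ^+ 'C(k, 2) = n%:R `^ (- (k%:R * (k%:R - 1) / d)).
  rewrite expp; congr (_ `^ - _); rewrite mulrAC; congr (_ / d).
  rewrite -natrM bin2 -divn2 [(2 * _)%N]mulnC divnK; last first.
    (* One of [k] and [k - 1] is even, so the halving in ['C(k, 2)] is exact. *)
    by rewrite dvdn2 oddM; case: (k) => //= m; rewrite andNb.
  by rewrite natrM -subn1 natrB // ltnW.
set E := (ex k n H)%:R => main.
set B := 'C(n, k)%:R in main.
set t := n%:R `^ (k%:R - _).
have tE : t = n%:R ^+ k * p ^+ 'C(k, 2).
  by rewrite pairsE -powR_mulrn ?ler0n // -powD.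
have B_ge : n%:R ^+ k <= M * B.
  by rewrite -natrX -natrM ler_nat expn_le_binomial.
have small : 2 * M * n%:R ^+ (k - 2) <= t.
  have -> : t = n%:R `^ eps * n%:R ^+ (k - 2).
    rewrite -powR_mulrn ?ler0n // -powD natrB // /eps; congr (_ `^ _); ring.
  by rewrite ler_wpM2r ?leN0 // exprn_ge0 // ltW.
rewrite mulrC ler_pdivrMr ?mulr_gt0 //.
have pC_ge0 : 0 <= p ^+ 'C(k, 2) by rewrite exprn_ge0 // powR_ge0.
have le_t : t <= M * (B * p ^+ 'C(k, 2)).
  by rewrite tE mulrA ler_wpM2r.
have le_main : B * p ^+ 'C(k, 2) <= E + n%:R ^+ (k - 2).
  by apply: le_trans main _; rewrite lerD2l -natrX ler_piMl.
apply: le_absorb small.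
exact: le_trans le_t (ler_wpM2l (ltW M_gt0) le_main).
Qed.
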